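(* Let $C\in\mathbb{R}^{n\times n}$ be a real circulant matrix, where $n=2m$ or $n=2m+1$, and let $U\in\mathbb{R}^{n\times n}$ and $\Omega\in\mathbb{R}^{n\times n}$ be the matrices defined in the context. Then $U$ is orthogonal and $U^{T}CU=\Omega$; that is, $\Omega$ is the real Schur form of $C$.
   Context: All indices start at $0$. A matrix $C=(c_{jk})_{j,k=0}^{n-1}$ is circulant if $c_{jk}=c_{j-k}$ and $c_{-l}=c_{n-l}$ for $1\le l\le n-1$. Let $\omega=\exp(2\pi i/n)$ and let $F=(F_{jk})_{j,k=0}^{n-1}$ with $F_{jk}=\frac{1}{\sqrt n}\omega^{-jk}$ be the DFT matrix. Write $F^*=[\boldsymbol f_0,\dots,\boldsymbol f_{n-1}]$ by columns; these are eigenvectors of $C$, and $\lambda_k$ denotes the eigenvalue with $C\boldsymbol f_k=\lambda_k\boldsymbol f_k$. Write $\lambda_k=\alpha_k+i\beta_k$ with $\alpha_k,\beta_k\in\mathbb{R}$, and $\boldsymbol f_k=\hat{\boldsymbol c}_k+i\hat{\boldsymbol s}_k$ with $\hat{\boldsymbol c}_k,\hat{\boldsymbol s}_k\in\mathbb{R}^n$. (For real $C$, $\lambda_{n-k}=\bar\lambda_k$ for $1\le k\le n-1$; $\lambda_0$ is real, and $\lambda_m$ is real if $n=2m$.) Definition of $U$ (by columns): - if $n=2m$: $U=[\hat{\boldsymbol c}_0,\sqrt2\,\hat{\boldsymbol c}_1,\dots,\sqrt2\,\hat{\boldsymbol c}_{m-1},\hat{\boldsymbol c}_m,\sqrt2\,\hat{\boldsymbol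 s}_{m-1},\dots,\sqrt2\,\hat{\boldsymbol s}_1]$; - if $n=2m+1$: $U=[\hat{\boldsymbol c}_0,\sqrt2\,\hat{\boldsymbol c}_1,\dots,\sqrt2\,\hat{\boldsymbol c}_m,\sqrt2\,\hat{\boldsymbol s}_m,\dots,\sqrt2\,\hat{\boldsymbol s}_1]$. Definition of $\Omega=(\Omega_{jk})_{j,k=0}^{n-1}$: all entries are zero except - if $n=2m$: $\Omega_{00}=\alpha_0$, $\Omega_{mm}=\alpha_m$, and for $1\le k\le m-1$: $\Omega_{k,k}=\Omega_{n-k,n-k}=\alpha_k$, $\Omega_{k,n-k}=\beta_k$, $\Omega_{n-k,k}=-\beta_k$; - if $n=2m+1$: $\Omega_{00}=\alpha_0$, and for $1\le k\le m$: $\Omega_{k,k}=\Omega_{n-k,n-k}=\alpha_k$, $\Omega_{k,n-k}=\beta_k$, $\Omega_{n-k,k}=-\beta_k$. A matrix of this shape can be brought by a permutation similarity to the usual block-diagonal real Schur canonical form with diagonal blocks of size $1$ and $2$; for this reason $\Omega$, being orthogonally similar to $C$, is itself called the real Schur form of $C$. *)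

(* Defs.v *)
From HB Require Import structures.
From mathcomp Require Import all_boot all_order all_algebra all_fingroup.
From mathcomp Require Import all_classical all_reals all_analysis.
From mathcomp Require Import complex.

Set Implicit Arguments.
Unset Strict Implicit.
Unset Printing Implicit Defensive.

Import Order.TTheory GRing.Theory Num.Theory.
Local Open Scope classical_set_scope.
Local Open Scope complex_scope.
Local Open Scope ring_scope.

(* The symbol [c] is indexed by integers; only its values on [-(n-1), n-1]
   are relevant. *)
Definition is_circulant (R : Type) (n : nat) (C : 'M[R]_n) : Prop :=
  exists c : int -> R,
    (forall j k : 'I_n, C j k = c (j%:Z - k%:Z)) /\
    (forall l : nat, (1 <= l <= n.-1)%N -> c (- l%:Z) = c (n%:Z - l%:Z)).

Definition orthogonal_mx (R : pzRingType) (n : nat) (Q : 'M[R]_n) : Prop :=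
  Q^T *m Q = 1%:M /\ Q *m Q^T = 1%:M.

Section Fourier.
Variables (R : realType) (n : nat).

Definition cexp (z : R[i]) : R[i] :=
  (expR (complex.Re z))%:C * (cos (complex.Im z) +i* sin (complex.Im z)).

Definition omega : R[i] := cexp (0 +i* (2 * pi / n%:R)).

Definition dft : 'M[R[i]]_n :=
  \matrix_(j, k) (((Num.sqrt n%:R)^-1)%:C * omega ^- (j * k)).

Definition dft_adj : 'M[R[i]]_n := (map_mx conjc dft)^T.

Definition fvec (k : 'I_n) : 'cV[R[i]]_n := col k dft_adj.

Definition cvec (k : 'I_n) : 'cV[R]_n := map_mx (@complex.Re R) (fvec k).
Definition svec (k : 'I_n) : 'cV[R]_n := map_mx (@complex.Im R) (fvec k).

(* [xget 0 P] is an element of [P] whenever [P] is nonempty. Here, when [C] is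
   circulant, [P] is a singleton: [fvec k] is a (nonzero) eigenvector. *)
Definition eigval (C : 'M[R]_n) (k : 'I_n) : R[i] :=
  xget 0 [set l : R[i] | map_mx (real_complex R) C *m fvec k = l *: fvec k].

Definition alpha (C : 'M[R]_n) (k : 'I_n) : R := complex.Re (eigval C k).
Definition beta (C : 'M[R]_n) (k : 'I_n) : R := complex.Im (eigval C k).

(* The index n - k for k > 0; the index 0 is sent to itself. *)
Definition refl_ord (k : 'I_n) : 'I_n := insubd k (n - k)%N.

(* [Umx] and [Omega] are meant for n = 2m or n = 2m+1. *)
Definition Ucol (m : nat) (k : 'I_n) : 'cV[R]_n :=
  if k == 0%N :> nat then cvec k
  else if (k < m)%N then Num.sqrt 2 *: cvec k
  else if k == m :> nat then
    if n == (2 * m)%N then cvec k else Num.sqrt 2 *: cvec k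
  else Num.sqrt 2 *: svec (refl_ord k).

Definition Umx (m : nat) : 'M[R]_n := \matrix_(j, k) Ucol m k j 0.

(* An entry (j, k) with j + k = n and j <> k is either (k', n - k') or
   (n - k', k') where k' = min(j, k) satisfies 1 <= k' < n / 2. *)
Definition Omega (m : nat) (C : 'M[R]_n) : 'M[R]_n :=
  \matrix_(j, k)
    if j == k then
      if (k <= m)%N then alpha C k else alpha C (refl_ord k)
    else if (j + k == n)%N then
      if (j < k)%N then beta C j else - beta C k
    else 0.

End Fourier.

(* Block diagonal with consecutive diagonal blocks of size 1 or 2, the blocks
   of size 2 being of the form [a, b; -b, a]; [b i] is the number of the block
   containing the index [i]. *)
Definition is_block_schur (R : pzRingType) (n : nat) (T : 'M[R]_n) : Prop :=
  exists b : 'I_n -> nat,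
    [/\ (forall i j : 'I_n, (i <= j)%N -> (b i <= b j)%N),
        (forall l : nat, (#|[set i : 'I_n | b i == l]%SET| <= 2)%N),
        (forall i j : 'I_n, b i <> b j -> T i j = 0) &
        (forall i j : 'I_n, (i < j)%N -> b i = b j ->
           T j j = T i i /\ T j i = - T i j)].

(* Up to a permutation similarity, as the 2 x 2 blocks of the matrix [Omega]
   do not occupy consecutive indices. *)
Definition is_real_schur_form (R : pzRingType) (n : nat) (C S : 'M[R]_n) :
    Prop :=
  (exists Q : 'M[R]_n, orthogonal_mx Q /\ Q^T *m C *m Q = S) /\
  (exists s : 'S_n, is_block_schur (perm_mx s *m S *m (perm_mx s)^T)).

(* Main.v *)
(* With j - k read modulo n, shifting the summation index shows that f_k is an
   eigenvector of C; the real and imaginary parts of C f_k = lambda_k f_k are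
   C c_k = alpha_k c_k - beta_k s_k and C s_k = alpha_k s_k + beta_k c_k, which
   is C U = U Omega read column by column. Orthogonality of U reduces, via the
   product formulas for cos and sin, to the vanishing of the geometric sums
   of exp(2 pi i j p / n) over j when n does not divide p. *)
Require Import Defs.
From mathcomp Require Import all_boot all_order all_algebra all_reals.
From mathcomp Require Import all_fingroup classical_sets trigo exp.
From mathcomp Require Import complex ring lra zify.

Set Implicit Arguments.
Unset Strict Implicit.
Unset Printing Implicit Defensive.

Import Order.TTheory GRing.Theory Num.Theory.
Local Open Scope ring_scope.

(** * Powers of the primitive n-th root of unity and their sums *)

Section Trigonometry.
Variable R : realType.
Implicit Types (x y : R) (n p : nat).

Definition expi x : R[i] := Complex (cos x) (sin x).

Lemma expiD x y : expi (x + y) = expi x * expi y.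
Proof.
rewrite /expi cosD sinD; apply/eqP; rewrite eq_complex /=.
by apply/andP; split; apply/eqP; ring.
Qed.

Lemma expi0 : expi 0 = 1.
Proof. by rewrite /expi cos0 sin0. Qed.

Lemma expi_exp x n : expi x ^+ n = expi (x * n%:R).
Proof.
elim: n => [|n IHn]; first by rewrite mulr0 expi0.
by rewrite exprS IHn -expiD -[n.+1]add1n natrD mulrDr mulr1.
Qed.

Lemma expi_mul_conj x : expi x * conjc (expi x) = 1.
Proof.
have := cos2Dsin2 x; rewrite !expr2 => e.
apply/eqP; rewrite eq_complex /=.
by apply/andP; split; apply/eqP; [rewrite -e|]; ring.
Qed.

Lemma expi_conj x : conjc (expi x) = (expi x)^-1.
Proof. by apply: divr1_eq; rewrite invrK mulrC expi_mul_conj. Qed.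

(** The argument of [omega ^+ p], left unreduced modulo 2 pi so that it is additive in [p]. *)
Definition angle n p : R := 2 * pi / n%:R * p%:R.

Lemma angleD n p q : angle n (p + q) = angle n p + angle n q.
Proof. by rewrite /angle natrD mulrDr. Qed.

Lemma angle_mul n p : (0 < n)%N -> angle n (n * p) = 2 * pi * p%:R.
Proof.
by move=> n0; rewrite /angle natrM mulrA divfK // pnatr_eq0 -lt0n.
Qed.

Lemma expi_2pi p : expi (2 * pi * p%:R) = 1.
Proof.
rewrite -expi_exp mulr_natl mulr2n expiD /expi cospi sinpi.
rewrite (_ : _ * _ = 1) ?expr1n //; apply/eqP; rewrite eq_complex /=.
by apply/andP; split; apply/eqP; ring.
Qed.

Lemma expi_angle_mod n p : (0 < n)%N ->
  expi (angle n (p %% n)) = expi (angle n p).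
Proof.
move=> n0; rewrite {2}(divn_eq p n) angleD expiD mulnC angle_mul //.
by rewrite expi_2pi mul1r.
Qed.

Lemma expi_angle_neq1 n p : (0 < p < n)%N -> expi (angle n p) != 1.
Proof.
move=> /andP[p0 pn]; apply/eqP => -[] /eqP.
have n0 : (0 : R) < n%:R by rewrite ltr0n (ltn_trans p0).
pose y : R := pi / n%:R * p%:R.
(* Halving the angle puts [y] in (0, pi), where sin y > 0; then cos (2 y) = 1 - 2 sin^2 y < 1. *)
have -> : angle n p = y *+ 2 by rewrite /angle /y; ring.
have : 0 < sin y.
  apply: sin_gt0_pi; apply/andP; split.
    by rewrite mulr_gt0 // ?ltr0n // divr_gt0 // pi_gt0.
  rewrite /y mulrAC ltr_pdivrMr // ltr_pM2l ?pi_gt0 //.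
  by rewrite ltr_nat.
rewrite cos_mulr2n cos2sin2 => s0 /eqP e _.
have : 0 < sin y ^+ 2 by rewrite exprn_gt0.
lra.
Qed.

Lemma sum_expi_angle n p : (0 < n)%N ->
  \sum_(j < n) expi (angle n (j * p)) = if (n %| p)%N then n%:R else 0.
Proof.
move=> n0.
(* Reducing [p] modulo [n] gives a ratio to which [expi_angle_neq1] applies as soon as the remainder
   is nonzero. *)
have E j : expi (angle n (j * p)) = expi (angle n (p %% n)) ^+ j.
  rewrite expi_angle_mod // expi_exp /angle mulnC natrM.
  by rewrite !mulrA.
under eq_bigr do rewrite E.
case: ifP => [|ndvd].
  rewrite /dvdn => /eqP ->; rewrite /angle mulr0 expi0.
  under eq_bigr do rewrite expr1n.
  by rewrite sumr_const card_ord.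
have := subrX1 (expi (angle n (p %% n))) n.
rewrite -{1}E angle_mul // expi_2pi subrr => /esym/eqP.
rewrite mulf_eq0 subr_eq0 (negbTE (expi_angle_neq1 _)) => [/eqP //|].
by rewrite ltn_mod n0 andbT lt0n; move: ndvd; rewrite /dvdn => ->.
Qed.

Lemma sum_cos_angle n p : (0 < n)%N ->
  \sum_(j < n) cos (angle n (j * p)) = if (n %| p)%N then n%:R else 0.
Proof.
move=> n0; have /(congr1 (@complex.Re R)) := sum_expi_angle p n0.
rewrite raddf_sum => ->; case: ifP => // _.
by rewrite raddfMn.
Qed.

Lemma sum_sin_angle n p : (0 < n)%N -> \sum_(j < n) sin (angle n (j * p)) = 0.
Proof.
move=> n0; have /(congr1 (@complex.Im R)) := sum_expi_angle p n0.
rewrite raddf_sum => ->; case: ifP => // _.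
by rewrite raddfMn mul0rn.
Qed.

(** Here [n - k] plays the role of -k modulo [n], so that frequencies remain natural numbers. *)
Lemma angle_subl n j k : (0 < n)%N -> (k <= n)%N ->
  angle n (j * (n - k)) = 2 * pi * j%:R - angle n (j * k).
Proof.
move=> n0 kn; rewrite -(angle_mul _ n0); apply/eqP; rewrite eq_sym subr_eq.
by rewrite -angleD -mulnDr subnK // mulnC.
Qed.

Lemma expi_angle_subl n j k : (0 < n)%N -> (k <= n)%N ->
  expi (angle n (j * (n - k))) = conjc (expi (angle n (j * k))).
Proof.
move=> n0 kn; rewrite angle_subl // expiD expi_2pi mul1r.
by rewrite /expi cosN sinN.
Qed.

Lemma cos_angle_subl n j k : (0 < n)%N -> (k <= n)%N ->
  cos (angle n (j * (n - k))) = cos (angle n (j * k)).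
Proof. by move=> n0 kn; have [] := expi_angle_subl j n0 kn. Qed.

Lemma sin_angle_subl n j k : (0 < n)%N -> (k <= n)%N ->
  sin (angle n (j * (n - k))) = - sin (angle n (j * k)).
Proof. by move=> n0 kn; have [] := expi_angle_subl j n0 kn. Qed.

End Trigonometry.

Lemma val_refl_ord n (k : 'I_n) : (0 < k)%N -> refl_ord k = (n - k)%N :> nat.
Proof.
by move=> k0; rewrite val_insubd ltn_subrL k0 (leq_ltn_trans _ (ltn_ord k)).
Qed.

(** * Inner products of the real and imaginary parts of the Fourier vectors *)

Section Fourier.
Variables (R : realType) (n : nat) (n_gt0 : (0 < n)%N).
Local Notation cs j k := (cos (angle R n (j * k))).
Local Notation sn j k := (sin (angle R n (j * k))).
Local Notation D p := (if (n %| p)%N then n%:R else 0 : R).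

(** Product-to-sum formula, with [k + (n - l)] standing for k - l modulo [n]; [D p] is the value of
    the cosine sum of frequency [p]. *)
Lemma sum_cos_cos (k l : nat) : (l <= n)%N ->
  \sum_(j < n) cs j k * cs j l = (D (k + l) + D (k + (n - l))) / 2.
Proof.
move=> ln; rewrite -!sum_cos_angle // -big_split mulr_suml.
apply: eq_bigr => j _ /=.
rewrite !mulnDr !angleD !cosD cos_angle_subl // sin_angle_subl //; by field.
Qed.

Lemma sum_sin_sin (k l : nat) : (l <= n)%N ->
  \sum_(j < n) sn j k * sn j l = (D (k + (n - l)) - D (k + l)) / 2.
Proof.
move=> ln; rewrite -!sum_cos_angle // -sumrB mulr_suml.
apply: eq_bigr => j _ /=.
rewrite !mulnDr !angleD !cosD cos_angle_subl // sin_angle_subl //; by field.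
Qed.

Lemma sum_cos_sin (k l : nat) : (l <= n)%N ->
  \sum_(j < n) cs j k * sn j l = 0.
Proof.
move=> ln; transitivity ((\sum_(j < n) sn j (k + l) -
  \sum_(j < n) sn j (k + (n - l))) / 2); last first.
  by rewrite !sum_sin_angle // subrr mul0r.
rewrite -sumrB mulr_suml; apply: eq_bigr => j _ /=.
rewrite !mulnDr !angleD !sinD cos_angle_subl // sin_angle_subl //; by field.
Qed.

Local Notation s := ((Num.sqrt n%:R)^-1 : R).

(** The adjoint conjugates the entries of [dft]; as [omega] has modulus 1, its negative powers
    become positive ones. *)
Lemma fvecE (k : 'I_n) j :
  fvec R k j 0 = s%:C%C * expi (angle R n (j * k)).
Proof.
have wE : omega R n = expi (2 * pi / n%:R) by rewrite /omega /cexp expR0 mul1r.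
rewrite !mxE wE -expi_exp mulnC.
have := expi_conj (2 * pi / n%:R : R); move: (expi _) => z zE.
by rewrite rmorphM [X in _ * X]fmorphV rmorphXn /= zE exprVn invrK oppr0.
Qed.

Lemma cvecE (k : 'I_n) j : cvec R k j 0 = s * cs j k.
Proof. by rewrite mxE fvecE /= mul0r subr0. Qed.

Lemma svecE (k : 'I_n) j : svec R k j 0 = s * sn j k.
Proof. by rewrite mxE fvecE /= mul0r addr0. Qed.

Lemma svec_refl_ord (k : 'I_n) j : (0 < k)%N ->
  svec R (refl_ord k) j 0 = - svec R k j 0.
Proof.
move=> k0; rewrite !svecE val_refl_ord //.
by rewrite sin_angle_subl ?(ltnW (ltn_ord _)) // mulrN.
Qed.

(** For indices [k] and [l], both [k + l] and [k + (n - l)] are below [2n], so this turns the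
    divisibility tests in [D] into linear arithmetic. *)
Lemma dvdn_lt_double p : (p < n + n)%N -> (n %| p)%N = (p == 0)%N || (p == n)%N.
Proof.
move=> pn; apply/idP/orP => [/dvdnP[q pE]|[]/eqP ->]; rewrite ?dvdn0 ?dvdnn //.
have : (q < 2)%N by rewrite -(ltn_pmul2r n_gt0) -pE mul2n -addnn.
by move: pE; case: q => [|[|]] // -> _; [left|right]; rewrite ?mul1n.
Qed.

Lemma svec_eq0 (k j : 'I_n) : (n %| k + k)%N -> svec R k j 0 = 0.
Proof.
have kn := ltn_ord k.
rewrite svecE dvdn_lt_double; last by lia.
case/orP => /eqP kE.
  by rewrite (_ : nat_of_ord k = 0%N) ?muln0 /angle ?mulr0 ?sin0 ?mulr0 //; lia.
(* Now k = n / 2 is fixed by the reflection k -> n - k, so the sine equals its own opposite. *)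
have := sin_angle_subl R j n_gt0 (ltnW kn).
have -> : (n - k = k)%N by lia.
by move=> sE; rewrite (_ : sin _ = 0) ?mulr0 //; lra.
Qed.

(** * Orthogonality of [Umx] *)

Section Schur.
Variables (m : nat) (n_parity : n = (2 * m)%N \/ n = (2 * m + 1)%N).

(* [n] divides [2k] exactly for k = 0 and k = n / 2, where [svec k] vanishes. *)
Definition scale (k : 'I_n) : R := if (n %| k + k)%N then 1 else Num.sqrt 2.

(** Treats both parities at once and, since s_(n-k) = - s_k, expresses every column through its own
    index [k]. *)
Lemma UmxE j k : Umx R n m j k =
  if (k <= m)%N then scale k * cvec R k j 0
  else - (Num.sqrt 2 * svec R k j 0).
Proof.
rewrite mxE /Ucol /scale dvdn_lt_double; last by have := ltn_ord k; lia.
have kn := ltn_ord k.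
have [k0|k0] := eqVneq (nat_of_ord k) 0%N; first by rewrite k0 mul1r.
case: ltngtP => km.
- rewrite mxE ifF //; first by lia.
- by rewrite mxE svec_refl_ord ?lt0n // mulrN.
- have -> : (k + k == 0)%N || (k + k == n)%N = (n == (2 * m)%N) by lia.
  by case: ifP => _; rewrite ?mul1r // mxE.
Qed.

Lemma UmxTU : (Umx R n m)^T *m Umx R n m = 1%:M.
Proof.
have sn1 : s * s * n%:R = 1.
  rewrite -expr2 exprVn sqr_sqrtr ?ler0n // mulVf //.
  by rewrite pnatr_eq0 -lt0n.
have s2 : Num.sqrt 2 * Num.sqrt 2 = 2 :> R by rewrite -expr2 sqr_sqrtr.
apply/matrixP => k l; rewrite !mxE.
have kn := ltn_ord k; have ln := ltn_ord l.
under eq_bigr do rewrite mxE !UmxE !cvecE !svecE.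
move: (s) sn1 => t tn1.
rewrite -val_eqE /= /scale !dvdn_lt_double; [|lia..].
have [km|km] := leqP k m; have [lm|lm] := leqP l m.
- transitivity (t * t * scale k * scale l * \sum_(j < n) cs j k * cs j l).
    rewrite mulr_sumr; apply: eq_bigr => j _.
    by rewrite /scale !dvdn_lt_double; [ring|lia..].
  rewrite sum_cos_cos ?(ltnW (ltn_ord _)) // /scale !dvdn_lt_double; [|lia..].
  (* On the diagonal the sum of squares is [n] if [n] divides 2l and [n / 2] otherwise; in the
     latter case the two factors sqrt 2 in [scale] restore [n]. *)
  have [kl|kl] := eqVneq (nat_of_ord k) l.
    rewrite kl; have -> : (l + (n - l) == 0)%N || (l + (n - l) == n)%N by lia.
    case: ifP => _; first by rewrite -[RHS]tn1; field.
    transitivity (t * t * n%:R * (Num.sqrt 2 * Num.sqrt 2) / 2); first by field.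
    by rewrite tn1 s2 mul1r divff ?pnatr_eq0.
  have -> : (k + l == 0)%N || (k + l == n)%N = false by lia.
  have -> : (k + (n - l) == 0)%N || (k + (n - l) == n)%N = false by lia.
  by rewrite addr0 mul0r mulr0.
- transitivity (- (t * t * scale k * Num.sqrt 2) *
                \sum_(j < n) cs j k * sn j l).
    rewrite mulr_sumr; apply: eq_bigr => j _.
    by rewrite /scale !dvdn_lt_double; [ring|lia..].
  rewrite sum_cos_sin ?(ltnW (ltn_ord _)) // mulr0.
  by have -> : (k == l :> nat) = false by lia.
- transitivity (- (t * t * scale l * Num.sqrt 2) *
                \sum_(j < n) cs j l * sn j k).
    rewrite mulr_sumr; apply: eq_bigr => j _.
    by rewrite /scale !dvdn_lt_double; [ring|lia..].
  rewrite sum_cos_sin ?(ltnW (ltn_ord _)) // mulr0.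
  by have -> : (k == l :> nat) = false by lia.
- transitivity (t * t * (Num.sqrt 2 * Num.sqrt 2) *
                \sum_(j < n) sn j k * sn j l).
    by rewrite mulr_sumr; apply: eq_bigr => j _; ring.
  rewrite sum_sin_sin ?(ltnW (ltn_ord _)) // !dvdn_lt_double; [|lia..].
  (* Both indices exceed [m], hence n < k + l < 2n. *)
  have -> : (k + l == 0)%N || (k + l == n)%N = false by lia.
  have -> : (k + (n - l) == 0)%N || (k + (n - l) == n)%N = (k == l :> nat).
    by lia.
  case: ifP => _; last by rewrite subr0 mul0r mulr0.
  by rewrite subr0 s2 -[RHS]tn1; field.
Qed.

Lemma Umx_orthogonal : orthogonal_mx (Umx R n m).
Proof. by split; [|apply: mulmx1C]; apply: UmxTU. Qed.

End Schur.
End Fourier.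

(** * Eigenvectors of a circulant matrix and the relation C U = U Omega *)

Section Circulant.
Variables (R : realType) (n : nat) (n_gt0 : (0 < n)%N).
Variables (C : 'M[R]_n) (C_circ : is_circulant C).
Local Open Scope complex_scope.

Lemma circulant_fvec_eigen (k : 'I_n) :
  exists l : R[i], map_mx (real_complex R) C *m fvec R k = l *: fvec R k.
Proof.
(* Writing the size as a successor makes the index type the additive group Z/n. *)
move: C C_circ k; case: n n_gt0 => // n' n'0 A [c [Ac cN]] k.
have As (j l : 'I_n'.+1) : A j (l + j) = A 0 l.
  have := ltn_ord j; have := ltn_ord l; rewrite !Ac /= => ln jn.
  have [lj|lj] := ltnP (l + j)%N n'.+1.
    by rewrite modn_small //; congr c; lia.
  have -> : ((l + j) %% n'.+1 = l + j - n'.+1)%N.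
    by rewrite -{1}(subnK lj) modnDr modn_small //; lia.
  (* The sum wraps around, which forces l >= 1, as the circulant condition on [c] requires. *)
  transitivity (c (n'.+1%:Z - l%:Z)); first by congr c; lia.
  by rewrite -cN; [congr c|]; lia.
(* The eigenvalue is the Fourier sum of row 0 of the matrix; translating the summation index by [j]
   brings row [j] to row 0. *)
exists (\sum_l (A 0 l)%:C * expi (angle R n'.+1 (l * k))).
apply/matrixP => j i; rewrite ord1 mxE mxE fvecE // mulr_suml.
rewrite (reindex_inj (addIr j)); apply: eq_bigr => l _.
rewrite mxE As fvecE //.
have -> : expi (angle R n'.+1 ((l + j)%R * k)) =
    expi (angle R n'.+1 (l * k)) * expi (angle R n'.+1 (j * k)).
  rewrite -expiD -angleD -mulnDl -expi_angle_mod // modnMml expi_angle_mod //.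
by rewrite -[RHS]mulrA; congr (_ * _); rewrite mulrCA.
Qed.

Lemma eigvalP (k : 'I_n) :
  map_mx (real_complex R) C *m fvec R k = eigval C k *: fvec R k.
Proof. exact: (xgetPex 0 (circulant_fvec_eigen k)). Qed.

Lemma circulant_cvec (k j : 'I_n) : \sum_l C j l * cvec R k l 0 =
  alpha C k * cvec R k j 0 - beta C k * svec R k j 0.
Proof.
have /matrixP/(_ j 0)/(congr1 (@complex.Re R)) := eigvalP k.
rewrite [in LHS]mxE [in RHS]mxE raddf_sum /= => E.
rewrite [cvec R k j 0]mxE [svec R k j 0]mxE.
transitivity (complex.Re (eigval C k * fvec R k j 0)); last first.
  by rewrite /alpha /beta; case: (eigval C k) (fvec R k j 0) => a b [x y].
rewrite -E; apply: eq_bigr => l _; rewrite !mxE /=.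
by case: (conjc _) => x y /=; rewrite mul0r subr0.
Qed.

Lemma circulant_svec (k j : 'I_n) : \sum_l C j l * svec R k l 0 =
  alpha C k * svec R k j 0 + beta C k * cvec R k j 0.
Proof.
have /matrixP/(_ j 0)/(congr1 (@complex.Im R)) := eigvalP k.
rewrite [in LHS]mxE [in RHS]mxE raddf_sum /= => E.
rewrite [cvec R k j 0]mxE [svec R k j 0]mxE.
transitivity (complex.Im (eigval C k * fvec R k j 0)); last first.
  by rewrite /alpha /beta; case: (eigval C k) (fvec R k j 0) => a b [x y].
rewrite -E; apply: eq_bigr => l _; rewrite !mxE /=.
by case: (conjc _) => x y /=; rewrite mul0r addr0.
Qed.

Section Schur.
Variables (m : nat) (n_parity : n = (2 * m)%N \/ n = (2 * m + 1)%N).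

Lemma Omega_eq0 (j k : 'I_n) : j != k -> (j + k != n)%N -> Omega m C j k = 0.
Proof. by rewrite mxE => /negbTE -> /negbTE ->. Qed.

(** Column [k] of [Omega] is supported on the rows [k] and n - k, so each entry of the product on
    the right has at most two terms. *)
Lemma circulant_Umx : C *m Umx R n m = Umx R n m *m Omega m C.
Proof.
apply/matrixP => j k; rewrite !mxE.
have kn := ltn_ord k.
under eq_bigr do rewrite UmxE //.
rewrite [RHS](bigD1 k) //=.
(* If [n] divides 2k, then k = 0 or k = n / 2: only the diagonal entry survives and [svec k]
   vanishes. *)
have [k2|k2] := boolP (n %| k + k)%N.
  have := k2; rewrite dvdn_lt_double // => [k2'|]; last by lia.
  rewrite [X in _ = _ + X]big1 ?addr0; last first.
    move=> l lk; rewrite Omega_eq0 ?mulr0 //.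
    by move: lk; rewrite -val_eqE /=; have := ltn_ord l; lia.
  have km : (k <= m)%N by lia.
  rewrite UmxE // [Omega _ _ _ _]mxE eqxx km /scale k2.
  under eq_bigr do rewrite mul1r.
  by rewrite circulant_cvec svec_eq0 // mulr0 subr0 mul1r mulrC.
have := k2; rewrite dvdn_lt_double // => [k2'|]; last by lia.
have k0 : (0 < k)%N by lia.
have rE := val_refl_ord k0.
have rk : refl_ord k != k by rewrite -val_eqE /= rE; lia.
rewrite [X in _ = _ + X](bigD1 (refl_ord k)) //=.
rewrite [X in _ = _ + (_ + X)]big1; last first.
  move=> l /andP[lk lr]; rewrite Omega_eq0 ?mulr0 //.
  by move: lr; rewrite -val_eqE /= rE; have := ltn_ord l; lia.
rewrite addr0 !UmxE // ![Omega _ _ _ _]mxE eqxx (negbTE rk) svec_refl_ord //.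
rewrite rE /scale rE (negbTE k2) subnK ?eqxx; last by lia.
(* For k <= m the column is a cosine one, and column n - k is sqrt 2 s_k, weighted by - beta_k. *)
have [km|km] := leqP k m.
  have -> : (n - k <= m)%N = false by lia.
  have -> : (n - k < k)%N = false by lia.
  transitivity (Num.sqrt 2 * \sum_l C j l * cvec R k l 0).
    by rewrite mulr_sumr; apply: eq_bigr => l _; ring.
  rewrite circulant_cvec; ring.
have -> : (n - k <= m)%N by lia.
have -> : (n - k < k)%N by lia.
have -> : (n %| n - k + (n - k))%N = false.
  by rewrite dvdn_lt_double //; lia.
have r0 : (0 < refl_ord k)%N by rewrite rE; lia.
(* For k > m, [Omega] uses the eigenvalue of index n - k, so the sine column is turned back into
   [svec] at the reflected index. *)
transitivity (Num.sqrt 2 * \sum_l C j l * svec R (refl_ord k) l 0).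
  by rewrite mulr_sumr; apply: eq_bigr => l _; rewrite svec_refl_ord //; ring.
rewrite circulant_svec svec_refl_ord //; ring.
Qed.

End Schur.
End Circulant.

(** * A permutation making the 2 x 2 blocks consecutive *)

Section BlockOrder.
Variables (n : nat).

(* The order 0, 1, n - 1, 2, n - 2, ... of the indices. *)
Definition zigzag (i : nat) : nat :=
  (if i == 0 then 0 else if i %% 2 == 1 then i.+1 %/ 2 else n - i %/ 2)%N.

Lemma zigzag_lt (i : 'I_n) : (zigzag i < n)%N.
Proof. by have := ltn_ord i; rewrite /zigzag; do 2?case: ifP; lia. Qed.

Definition zigzag_ord (i : 'I_n) : 'I_n := Ordinal (zigzag_lt i).

Lemma zigzag_ord_inj : injective zigzag_ord.
Proof.
move=> i j /(congr1 val) /= ij; apply: val_inj => /=; move: ij.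
have := ltn_ord i; have := ltn_ord j; rewrite /zigzag.
by do 4?case: ifP; lia.
Qed.

Lemma Omega_block_schur (R : realType) (m : nat) (C : 'M[R]_n) :
  n = (2 * m)%N \/ n = (2 * m + 1)%N ->
  let P := perm_mx (perm zigzag_ord_inj) in
  is_block_schur (P *m Omega m C *m P^T).
Proof.
move=> n_parity P.
have PE i j : (P *m Omega m C *m P^T) i j =
    Omega m C (zigzag_ord i) (zigzag_ord j).
  by rewrite -row_permE tr_perm_mx -col_permE !mxE !permE.
(* The blocks are {0}, {1, 2}, {3, 4}, ...; positions 2q - 1 and 2q carry the indices q and n - q.
   For even [n] the last block is the single position n - 1, carrying [m]. *)
exists (fun i => (i.+1 %/ 2)%N); split.
- by move=> i j ij; lia.
- move=> l; rewrite cardE -(size_map val).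
  (* For l = 0 the truncated predecessor makes both listed values 0, which is harmless for an upper
     bound. *)
  apply: (@uniq_leq_size _ _ [:: (2 * l)%N; (2 * l).-1]).
    by rewrite (map_inj_uniq val_inj) enum_uniq.
  by move=> x; case/mapP => i; rewrite mem_enum !inE => + -> /=; lia.
- move=> i j bij; rewrite PE Omega_eq0 //.
    by apply/eqP => /zigzag_ord_inj ij; rewrite ij in bij.
  have := ltn_ord i; have := ltn_ord j.
  by rewrite /= /zigzag; do 4?case: ifP; lia.
- move=> i j ij bij; rewrite !PE.
  have jn := ltn_ord j.
  (* Two positions i < j in one block satisfy j = 2q and i = 2q - 1, with q = [j %/ 2]. *)
  have iE : zigzag_ord i = (j %/ 2)%N :> nat.
    by rewrite /= /zigzag; do 2?case: ifP; lia.
  have jE : zigzag_ord j = (n - j %/ 2)%N :> nat.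
    by rewrite /= /zigzag; do 2?case: ifP; lia.
  move: (zigzag_ord i) (zigzag_ord j) iE jE => i' j' iE jE.
  (* Beyond [m] the diagonal of [Omega] reads [alpha] at the reflected index, here [i'], so the two
     diagonal entries agree. *)
  have rE : refl_ord j' = i' by apply: val_inj; rewrite /= val_refl_ord; lia.
  rewrite !mxE !eqxx rE -!val_eqE /=.
  have -> : (i' <= m)%N by lia.
  have -> : (j' <= m)%N = false by lia.
  have -> : (i' == j' :> nat) = false by lia.
  have -> : (j' == i' :> nat) = false by lia.
  have -> : (i' + j' == n)%N by lia.
  have -> : (j' + i' == n)%N by lia.
  have -> : (i' < j')%N by lia.
  by have -> : (j' < i')%N = false by lia.
Qed.

End BlockOrder.

Theorem theorem2p4 (R : realType) (n m : nat) (n_gt0 : (0 < n)%N)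
    (n_parity : n = (2 * m)%N \/ n = (2 * m + 1)%N)
    (C : 'M[R]_n) (C_circ : is_circulant C) :
  [/\ orthogonal_mx (Umx R n m),
      (Umx R n m)^T *m C *m Umx R n m = Omega m C &
      is_real_schur_form C (Omega m C)].
Proof.
have U_orth := @Umx_orthogonal R n n_gt0 m n_parity.
have UCU : (Umx R n m)^T *m C *m Umx R n m = Omega m C.
  by rewrite -mulmxA circulant_Umx // mulmxA U_orth.1 mul1mx.
split=> //; split; first by exists (Umx R n m).
by exists (perm (@zigzag_ord_inj n)); apply: Omega_block_schur.
Qed.
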